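(* Let $\Bbbk$ be a field, $n\ge2$, $q\in\Bbbk$ a primitive $n$-th root of unity, $T_n(q)$ the Taft algebra and $A$ a unital associative $\Bbbk$-algebra. Let $\rho:A\to A\otimes T_n(q)$ be a linear map, written $\rho(a)=a^0\otimes a^1$, and for $0\le i<n$ set $A_i=\sum_{r=0}^{n-1}q^{-ir}(g^r)^*(1^1)1^0\in A$; put $w=\sum_{k=0}^{n-1}q^{-k}(g^kx)^*(1^1)1^0\in A$, and write $\rho(w)=w^0\otimes w^1$. Suppose $A_1\in\{0,1_A\}$. Then $\rho$ is a partial coaction of $T_n(q)$ on $A$ if and only if either $\rho$ is a global coaction, or $(I\otimes\pi)\rho:A\to A\otimes\Bbbk C_n$ is a partial coaction of $\Bbbk C_n$ on $A$ with $A_1=0$ and (i) for all $a\in A$, $\rho(a)=\sum_{i,j=0}^{n-1}\sum_{k=0}^{j}q^{-ij}(-1)^kq^{-\frac{k(k-1)}{2}}\binom{j}{k}_{q^{-1}}w^{j-k}\Big(\sum_{t=0}^{n-1}q^{-(i+k)t}(g^t)^*(a^1)a^0\Big)w^k\otimes\frac{1}{n}((j)_q!)^{-1}q^{ij+\frac{j(j-1)}{2}}\sum_{\ell=0}^{n-1}q^{\ell(i+j)}g^\ell x^j$; (ii) $w^n\in Z(A)$; (iii) for all $0\le i<n$, $\sum_{s=0}^{n-1}q^{-is}(g^s)^*(w^1)w^0=q^{-i}A_iw$.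
   Context: The Taft algebra $T_n(q)$ is the Hopf algebra generated by $g,x$ with relations $g^n=1$, $x^n=0$, $xg=qgx$, basis $\{g^ix^j:0\le i,j<n\}$, $g$ group-like, $\Delta(x)=x\otimes1+g\otimes x$, $\varepsilon(x)=0$. $\{(g^ix^j)^*\}$ denotes the dual basis of the basis $\{g^ix^j\}$. $\Bbbk C_n=\mathrm{span}\{1,g,\dots,g^{n-1}\}$ is the group Hopf algebra of the cyclic group $C_n=\langle g\rangle$, and $\pi:T_n(q)\to\Bbbk C_n$ is the linear projection $\pi(g^ix^j)=\delta_{j,0}g^i$. $Z(A)$ is the center of $A$. $q$-numbers: $(m)_q=\sum_{\ell=0}^{m-1}q^\ell$, $(0)_q!=1$, $(m)_q!=(m)_q(m-1)_q!$. $q$-binomials: $\binom{0}{0}_p=1$, $\binom{N}{m}_p=0$ if $m>N$ or $m<0$, and $\binom{N}{m}_p=\binom{N-1}{m-1}_p+p^m\binom{N-1}{m}_p$ for $N\ge1$, $0\le m\le N$. For a bialgebra $H$, a partial coaction of $H$ on $A$ is a linear map $\rho:A\to A\otimes H$ such that $(I\otimes\varepsilon)\rho(a)=a$, $\rho(ab)=\rho(a)\rho(b)$ and $(\rho\otimes I)\rho(a)=(\rho(1_A)\otimes 1_H)((I\otimes\Delta)\rho(a))$ for all $a,b\in A$; it is a global coaction if moreover $\rho(1_A)=1_A\otimes1_H$ (i.e. $A$ is an $H$-comodule algebra). *)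

(* Defs.v *)
From HB Require Import structures.
From mathcomp Require Import all_boot all_order all_algebra.
Set Implicit Arguments. Unset Strict Implicit. Unset Printing Implicit Defensive.
Import GRing.Theory.
Local Open Scope ring_scope.

(* Generic setting: H a finite dimensional Hopf algebra over K with basis    *)
(* (e_i)_{i : I}, given by structure constants:                              *)
(*    e_v e_w = \sum_s mulc v w s e_s,  Delta(e_u) = \sum_{s,t} copc u s t   *)
(*    e_s (x) e_t,  eps(e_u) = epsc u,   1_H = \sum_u unitc u e_u.           *)
(* An element of A (x) H is represented by its coefficient family           *)
(*    {ffun I -> A} : X = \sum_i X i (x) e_i.                                *)
(* For rho : A -> A (x) H written rho(a) = a^0 (x) a^1, rho a i = e_i^*(a^1) a^0. *)
Section Generic.
Variables (K : fieldType) (A : algType K) (I : finType).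

Definition tens_mul (mulc : I -> I -> I -> K) (M N : {ffun I -> A})
  : {ffun I -> A} :=
  [ffun s => \sum_(v : I) \sum_(w : I) mulc v w s *: (M v * N w)].

Definition tensor (a : A) (h : {ffun I -> K^o}) : {ffun I -> A} :=
  [ffun i => h i *: a].

(* Partial coaction axioms, coordinatewise:
   (I (x) eps) rho(a) = a ;  rho(ab) = rho(a) rho(b) ;
   (rho (x) I) rho(a) = (rho(1_A) (x) 1_H) ((I (x) Delta) rho(a)).
   The element of A (x) H (x) H at coordinate (s,t) on the left is
   rho (rho a t) s; on the right it is computed from the structure constants. *)
Definition is_partial_coaction (mulc copc : I -> I -> I -> K) (epsc : I -> K)
  (rho : A -> {ffun I -> A}) : Prop :=
  [/\ forall a : A, \sum_(i : I) epsc i *: rho a i = a,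
      forall a b : A, rho (a * b) = tens_mul mulc (rho a) (rho b) &
      forall (a : A) (s t : I),
        rho (rho a t) s =
        \sum_(v : I) \sum_(s' : I)
           mulc v s' s *: (rho 1 v * \sum_(u : I) copc u s' t *: rho a u)].

Definition is_global_coaction (mulc copc : I -> I -> I -> K) (epsc unitc : I -> K)
  (rho : A -> {ffun I -> A}) : Prop :=
  is_partial_coaction mulc copc epsc rho /\ rho 1 = tensor 1 [ffun u => unitc u].

End Generic.

Section QNumbers.
Variable K : fieldType.

Definition qnum (p : K) (m : nat) : K := \sum_(l < m) p ^+ l.

Fixpoint qfact (p : K) (m : nat) : K :=
  match m with 0 => 1 | m'.+1 => qnum p m'.+1 * qfact p m' end.

Fixpoint qbinom (p : K) (N m : nat) : K :=
  match N, m with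
  | 0, 0 => 1
  | 0, _.+1 => 0
  | N'.+1, 0 => qbinom p N' 0
  | N'.+1, m'.+1 => qbinom p N' m' + p ^+ m'.+1 * qbinom p N' m'.+1
  end.
End QNumbers.

(* The Taft algebra T_n(q): basis g^i x^j, indexed by (i,j) : 'I_n * 'I_n.  *)
Section Taft.
Variables (K : fieldType) (n : nat) (q : K).

(* (g^i1 x^j1)(g^i2 x^j2) = q^(j1 i2) g^(i1+i2 mod n) x^(j1+j2)  (0 if j1+j2 >= n) *)
Definition taft_mulc (v w s : 'I_n * 'I_n) : K :=
  if (((v.1 + w.1) %% n)%N == s.1 :> nat) && ((v.2 + w.2)%N == s.2 :> nat)
  then q ^+ (v.2 * w.1) else 0.

(* Delta(g^i x^j) = \sum_m binom(j,m)_q g^(i+m) x^(j-m) (x) g^i x^m *)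
Definition taft_copc (u s t : 'I_n * 'I_n) : K :=
  if [&& (t.1 == u.1 :> nat), (t.2 <= u.2)%N, (s.2 == (u.2 - t.2)%N :> nat)
       & (s.1 == ((u.1 + t.2) %% n)%N :> nat)]
  then qbinom q u.2 t.2 else 0.

Definition taft_epsc (u : 'I_n * 'I_n) : K := if (u.2 == 0%N :> nat) then 1 else 0.

Definition taft_unitc (u : 'I_n * 'I_n) : K :=
  if (u.1 == 0%N :> nat) && (u.2 == 0%N :> nat) then 1 else 0.

Definition taft_basis (i j : 'I_n) : {ffun 'I_n * 'I_n -> K^o} :=
  [ffun u => if u == (i, j) then 1 else 0].

(* group algebra k C_n, basis g^i, i : 'I_n *)
Definition grp_mulc (v w s : 'I_n) : K :=
  if (((v + w) %% n)%N == s :> nat) then 1 else 0.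
Definition grp_copc (u s t : 'I_n) : K :=
  if (s == u) && (t == u) then 1 else 0.
Definition grp_epsc (u : 'I_n) : K := 1.
End Taft.

Section TaftCoaction.
Variables (K : fieldType) (A : algType K) (n : nat) (q : K).
Variable rho : A -> {ffun 'I_n * 'I_n -> A}.

(* (I (x) pi) rho, pi(g^i x^j) = delta_{j,0} g^i *)
Definition proj_rho (a : A) : {ffun 'I_n -> A} :=
  [ffun i => \sum_(u : 'I_n * 'I_n | (u.1 == i) && (u.2 == 0%N :> nat)) rho a u].

Definition Pcomp (m : nat) (a : A) : A :=
  \sum_(t : 'I_n) (q^-1) ^+ (m * t) *: \sum_(u : 'I_n * 'I_n | (u.1 == t) && (u.2 == 0%N :> nat)) rho a u.

Definition Acomp (i : nat) : A := Pcomp i 1.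

Definition wel : A :=
  \sum_(k : 'I_n) (q^-1) ^+ k *: \sum_(u : 'I_n * 'I_n | (u.1 == k) && (u.2 == 1%N :> nat)) rho 1 u.
End TaftCoaction.

(* Main.v *)
Require Import Defs.
From HB Require Import structures.
From mathcomp Require Import all_boot all_order all_algebra.
From mathcomp Require Import ring.
Set Implicit Arguments.
Unset Strict Implicit.
Unset Printing Implicit Defensive.
Import GRing.Theory.
Local Open Scope ring_scope.

(** For an n-th root of unity z put
      D_j(z) a = sum_l z^l (g^l x^j)^*(a^1) a^0.
    By Fourier inversion these operators determine rho, and multiplicativity
    and coassociativity of a partial coaction become
      D_j(z)(ab) = sum_{i <= j} D_i(z)(a) D_{j-i}(z q^i)(b),
      D_j(z)(D_k(y) a) = sum_{i <= j} (z q^i)^k binom(j-i+k, k)_q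
                           D_i(z)(1) D_{j-i+k}(y z q^i)(a).
    The operators D_0(z) describe (I (x) pi) rho, D_0(q^-i)(1) = A_i and
    D_1(q^-1)(1) = w.  If A_1 = 0, the second identity at j = z = 1 is the
    recursion
      (k+1)_q D_{k+1}(y) a = q^k w D_k(y q) a - D_k(y) a w,
    whose solution is (i) and whose instance k = n - 1 is (ii).  Conversely
    this recursion determines its solutions in degrees < n from degree 0 and is
    stable under the above convolution, so that both identities follow from
    their cases j = 0, which are the group coaction axioms and (iii).
    If A_1 = 1 then w = 0, hence D_j(z)(1) = 0 for j > 0 and rho is global. *)

(** * q-numbers and q-binomial coefficients *)

Section QBinomials.
Variables (K : fieldType) (p : K).

Lemma qnumS m : qnum p m.+1 = qnum p m + p ^+ m.
Proof. by rewrite /qnum big_ord_recr. Qed.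

Lemma qnum0 : qnum p 0 = 0.
Proof. by rewrite /qnum big_ord0. Qed.

Lemma qnumD a b : qnum p (a + b) = qnum p a + p ^+ a * qnum p b.
Proof.
elim: b => [|b IH]; first by rewrite addn0 qnum0 mulr0 addr0.
by rewrite addnS !qnumS IH exprD mulrDr addrA.
Qed.

Lemma qnum_subr1 m : (p - 1) * qnum p m = p ^+ m - 1.
Proof. by rewrite subrX1. Qed.

Lemma qbinom0 N : qbinom p N 0 = 1.
Proof. by elim: N. Qed.

Lemma qbinom_small N m : (N < m)%N -> qbinom p N m = 0.
Proof.
elim: N m => [|N IH] [|m] //= ltNm.
by rewrite !IH ?mulr0 ?addr0 // ltnW.
Qed.

Lemma qbinomn N : qbinom p N N = 1.
Proof. by elim: N => //= N ->; rewrite qbinom_small // mulr0 addr0. Qed.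

Lemma qbinomS N m :
  qbinom p N.+1 m.+1 = qbinom p N m + p ^+ m.+1 * qbinom p N m.+1.
Proof. by []. Qed.

Lemma qbinom_pascal2 N m : (m <= N)%N ->
  qbinom p N.+1 m.+1 = qbinom p N m.+1 + p ^+ (N - m) * qbinom p N m.
Proof.
elim: N m => [|N IH] [|m] // lemN.
- by rewrite /= !mulr0 addr0 add0r !mul1r.
- rewrite qbinomS {1}IH // qbinomS !qbinom0 !subn0 !exprS; ring.
rewrite ltnS in lemN; rewrite qbinomS subSS.
case: (ltngtP m N) lemN => // [ltmN _|-> _]; last first.
  by rewrite subnn !qbinomn (@qbinom_small N.+1) //; ring.
rewrite {1}(IH m.+1 ltmN) {1}(IH m (ltnW ltmN)) !qbinomS -(subnSK ltmN) !exprS; ring.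
Qed.

(** The two identities share one induction, because the inductive step of each draws on both. They
    avoid division since q-numbers can vanish at a root of unity. *)
Lemma qbinom_absorb N m :
  qnum p m.+1 * qbinom p N.+1 m.+1 = qnum p N.+1 * qbinom p N m
  /\ ((m <= N)%N -> qnum p (N.+1 - m) * qbinom p N.+1 m = qnum p N.+1 * qbinom p N m).
Proof.
elim: N m => [|N IH] m.
  case: m => [|m]; split=> //; first by rewrite /= mulr0 addr0.
  by rewrite !qbinom_small // !mulr0.
have top k : qnum p k.+1 * qbinom p N.+2 k.+1 = qnum p N.+2 * qbinom p N.+1 k.
  rewrite qbinomS mulrDr mulrCA (IH k).1.
  case: (leqP k N.+1) => [lekN|ltNk]; last first.
    by rewrite !(@qbinom_small _ k) ?mulr0 ?addr0 // ltnW.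
  case: (ltngtP k N.+1) lekN => // [ltkN _|-> _]; last first.
    by rewrite (@qbinom_small N) // !mulr0 addr0.
  by rewrite -((IH k).2 ltkN) -[in RHS](subnKC (ltnW ltkN : k < N.+2)%N) qnumD subSS; ring.
split=> // lemN.
case: m lemN => [|m] lemN; first by rewrite !qbinom0 subn0.
rewrite qbinomS mulrDr subSS (IH m).2 // mulrCA -(IH m).1.
rewrite -[in RHS](subnKC (ltnW lemN : m.+1 <= N.+2)%N) qnumD subSS.
ring.
Qed.
End QBinomials.

(** * Primitive roots of unity *)

Section RootsOfUnity.
Variables (K : fieldType) (n : nat) (q : K).
Hypotheses (Hn : (2 <= n)%N) (Hq : n.-primitive_root q).

Lemma prim_root_inv : n.-primitive_root q^-1.
Proof.
case: n Hn Hq => // m _ /andP [_ /forallP prq]; apply/andP; split=> //.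
by apply/forallP=> i; rewrite unity_rootE exprVn invr_eq1 -unity_rootE; apply: prq.
Qed.

Lemma prim_root_qnum0 : qnum q n = 0.
Proof.
have q1 : q - 1 != 0.
  by rewrite subr_eq0 -[q]expr1 -(prim_order_dvd Hq) dvdn1 neq_ltn Hn orbT.
by apply: (mulfI q1); rewrite qnum_subr1 (prim_expr_order Hq) subrr mulr0.
Qed.

Lemma prim_root_qnum_neq0 k : (0 < k < n)%N -> qnum q k != 0.
Proof.
case/andP=> k0 ltkn; apply/eqP=> qk0; move: (qnum_subr1 q k).
rewrite qk0 mulr0 => /esym/eqP; rewrite subr_eq0 -(prim_order_dvd Hq).
by rewrite gtnNdvd.
Qed.

Lemma prim_root_qfact_neq0 k : (k < n)%N -> qfact q k != 0.
Proof.
elim: k => [|k IH] ltkn /=; first exact: oner_neq0.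
by rewrite mulf_neq0 ?prim_root_qnum_neq0 // IH // ltnW.
Qed.

Lemma sum_expr_unity_root (z : K) :
  z ^+ n = 1 -> \sum_(l < n) z ^+ l = if z == 1 then n%:R else 0.
Proof.
move=> zn; case: eqP => [->|/eqP z1].
  by under eq_bigr do rewrite expr1n; rewrite sumr_const card_ord.
have z1' : z - 1 != 0 by rewrite subr_eq0.
by apply: (mulfI z1'); rewrite -subrX1 zn subrr mulr0.
Qed.

(** For odd [n] the exponent is a multiple of [n]. For even [n], [q^(n/2)] squares to 1 without
    being 1, and it is raised to the odd power [n - 1]. *)
Lemma prim_root_sign : (-1) ^+ n * q ^+ ((n * (n - 1)) %/ 2) = -1.
Proof.
have qn := prim_expr_order Hq.
case: (boolP (odd n)) => on.
  have /dvdnP[m Em] : (2 %| n - 1)%N by rewrite dvdn2 oddB ?on // ltnW.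
  rewrite Em mulnA mulnK // exprM qn expr1n mulr1 -signr_odd on //.
have /dvdnP[m Em] : (2 %| n)%N by rewrite dvdn2.
have qm : q ^+ m = -1.
  have /eqP : (q ^+ m) ^+ 2 = 1 by rewrite -exprM -Em.
  rewrite sqrf_eq1 -(prim_order_dvd Hq) => /orP[|/eqP //].
  rewrite gtnNdvd //.
    by move: Hn; rewrite Em; case: (m).
  by rewrite Em -{1}[m]muln1 ltn_pmul2l //; move: Hn; rewrite Em; case: (m).
rewrite -signr_odd (negbTE on) mul1r mulnC {2}Em mulnA mulnK // mulnC exprM qm.
by rewrite -signr_odd oddB ?(negbTE on) ?expr1 // ltnW.
Qed.
End RootsOfUnity.

(** * The recursion *)

Section TaftRecursion.
Variables (K : fieldType) (A : algType K) (n : nat) (q : K).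

(** All [k] are allowed: at [k = n - 1], for primitive [q], [(n)_q = 0] and the relation no longer
    computes [U n] but constrains [U (n - 1)]. *)
Definition taft_rec (w : A) (U : nat -> K -> A) :=
  forall k y, y ^+ n = 1 ->
  qnum q k.+1 *: U k.+1 y = q ^+ k *: (w * U k (y * q)) - U k y * w.

(** A Leibniz rule twisted by the shift [z * q ^+ i]. The right-hand sides of the multiplicativity
    and coassociativity identities are convolutions of this shape. *)
Lemma taft_rec_conv w U V : q ^+ n = 1 -> taft_rec w U -> taft_rec w V ->
  taft_rec w (fun j z => \sum_(i < j.+1) U i z * V (j - i)%N (z * q ^+ i)).
Proof.
move=> qn recU recV j z zn.
have zqn i : (z * q ^+ i) ^+ n = 1 by rewrite exprMn zn -exprM mulnC exprM qn expr1n mulr1.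
(* Split (j+1)_q = (j+1-i)_q + q^(j+1-i) (i)_q and apply the recursion to V,
   resp. U; the mixed terms U_i(z) w V_(j-i)(z q^(i+1)) then cancel. *)
have -> : qnum q j.+1 *: (\sum_(i < j.+2) U i z * V (j.+1 - i)%N (z * q ^+ i))
  = \sum_(i < j.+1) (U i z * (qnum q (j - i).+1 *: V (j - i).+1 (z * q ^+ i))
      + q ^+ (j - i) *: (qnum q i.+1 *: U i.+1 z * V (j - i)%N (z * q ^+ i.+1))).
  have -> : qnum q j.+1 *: (\sum_(i < j.+2) U i z * V (j.+1 - i)%N (z * q ^+ i))
    = \sum_(i < j.+2) (qnum q (j.+1 - i) *: (U i z * V (j.+1 - i)%N (z * q ^+ i)))
    + \sum_(i < j.+2)
        ((q ^+ (j.+1 - i) * qnum q i) *: (U i z * V (j.+1 - i)%N (z * q ^+ i))).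
    rewrite scaler_sumr -big_split; apply: eq_bigr => i _ /=.
    by rewrite -scalerDl -qnumD subnK // -ltnS.
  (* As [(0)_q = 0], the first sum loses its term [i = j + 1] and the second its term [i = 0];
     reindexing the second gives both the range [i <= j]. *)
  rewrite big_ord_recr /= subnn qnum0 scale0r addr0.
  rewrite [X in _ + X]big_ord_recl /= qnum0 mulr0 scale0r add0r -big_split.
  apply: eq_bigr => i _ /=; rewrite subSn -1?ltnS // !scalerAr /bump add1n subSS.
  by congr (_ + _); rewrite -scalerAl -!scalerAr scalerA mulrC.
rewrite mulr_sumr mulr_suml scaler_sumr -sumrB.
apply: eq_bigr => i _; rewrite recV // recU // exprSr !mulrA.
have -> : z * q * q ^+ i = z * q ^+ i * q by rewrite mulrAC.
rewrite mulrBr mulrBl scalerBr -scalerAr -!scalerAl scalerA -exprD subnK -1?ltnS //.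
by rewrite !mulrA addrC addrA subrK.
Qed.

(** Below degree [n] the factor [(j+1)_q] can be cancelled, so each degree is computed from the
    previous one. *)
Lemma taft_rec_inj w U V : (forall k, (0 < k < n)%N -> qnum q k != 0) ->
  q ^+ n = 1 -> taft_rec w U -> taft_rec w V ->
  (forall y, y ^+ n = 1 -> U 0%N y = V 0%N y) ->
  forall j y, (j < n)%N -> y ^+ n = 1 -> U j y = V j y.
Proof.
move=> qnz qn recU recV UV0; elim=> [|j IH] y ltjn yn; first exact: UV0.
apply: (scalerI (qnz j.+1 ltjn)); rewrite recU // recV //.
by rewrite !IH ?exprMn ?yn ?qn ?mulr1 // ltnW.
Qed.

(** The coefficient of [X^k] in the Gauss product of the factors [1 - q^-i X] for [i < j]. *)
Definition taft_coef (j k : nat) : K :=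
  (-1) ^+ k * q^-1 ^+ ((k * (k - 1)) %/ 2) * qbinom q^-1 j k.

(* If E (q^-m) = P_m(a), the value at z = q^-i is the element of A in the (i, j)
   term of (i), up to the factor q^-ij. *)
Definition taft_sum (w : A) (E : K -> A) (j : nat) (z : K) : A :=
  \sum_(k < j.+1) taft_coef j k *: (w ^+ (j - k) * E (z * q^-1 ^+ k) * w ^+ k).

Lemma triangularS k : ((k.+1 * (k.+1 - 1)) %/ 2 = (k * (k - 1)) %/ 2 + k)%N.
Proof. by rewrite !divn2 !subn1 -!bin2 binS bin1 addnC. Qed.

Lemma taft_coef0 j : taft_coef j 0 = 1.
Proof. by rewrite /taft_coef qbinom0 !mulr1. Qed.

Lemma taft_coefS j k : (k <= j)%N ->
  taft_coef j.+1 k.+1 = taft_coef j k.+1 - q^-1 ^+ j * taft_coef j k.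
Proof.
move=> lekj; rewrite /taft_coef qbinom_pascal2 // triangularS.
have -> : q^-1 ^+ j = q^-1 ^+ (j - k) * q^-1 ^+ k by rewrite -exprD subnK.
by rewrite !exprD exprS; ring.
Qed.

Lemma taft_sum0 w E z : taft_sum w E 0 z = E z.
Proof. by rewrite /taft_sum big_ord1 taft_coef0 scale1r !expr0 mulr1 mul1r mulr1. Qed.

(** This is multiplication by the next Gauss factor [1 - q^-j X]: 1 acts as left multiplication by
    [w], and [X] as right multiplication by [w] combined with the shift of [z] by [q^-1]. *)
Lemma taft_sumS w E j z :
  taft_sum w E j.+1 z
  = w * taft_sum w E j z - q^-1 ^+ j *: (taft_sum w E j (z * q^-1) * w).
Proof.
pose T k := w ^+ (j.+1 - k) * E (z * q^-1 ^+ k) * w ^+ k.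
have -> : w * taft_sum w E j z = \sum_(k < j.+2) taft_coef j k *: T k.
  rewrite big_ord_recr /= {2}/taft_coef qbinom_small // mulr0 scale0r addr0.
  rewrite mulr_sumr; apply: eq_bigr => k _.
  by rewrite /T subSn -1?ltnS // exprS -scalerAr !mulrA.
have -> : q^-1 ^+ j *: (taft_sum w E j (z * q^-1) * w)
  = \sum_(k < j.+1) (q^-1 ^+ j * taft_coef j k) *: T k.+1.
  rewrite mulr_suml scaler_sumr; apply: eq_bigr => k _.
  by rewrite -scalerA -scalerAl /T subSS -(mulrA z) -exprS -(mulrA _ _ w) -exprSr.
rewrite -sumrN [X in _ = X + _]big_ord_recl -addrA -big_split /=.
rewrite /taft_sum big_ord_recl !taft_coef0; congr (_ + _).
by apply: eq_bigr => k _; rewrite taft_coefS -1?ltnS // scalerBl.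
Qed.

(** For [j = n] the Gauss product collapses to [1 - X^n]: absorption kills the inner binomials, and
    [prim_root_sign] gives the last coefficient. What remains is a commutator with [w ^+ n]. *)
Lemma taft_sum_prim w E z : (2 <= n)%N -> n.-primitive_root q ->
  taft_sum w E n z = w ^+ n * E z - E z * w ^+ n.
Proof.
move=> Hn Hq; have Hp := prim_root_inv Hn Hq.
have [m En] : exists m, n = m.+1 by case: (n) Hn => // m; exists m.
pose T k := taft_coef n k *: (w ^+ (n - k) * E (z * q^-1 ^+ k) * w ^+ k).
have T0 k : (0 < k < n)%N -> T k = 0.
  move=> k0; suff : qbinom q^-1 n k = 0 by rewrite /T /taft_coef => ->; rewrite mulr0 scale0r.
  apply: (mulfI (prim_root_qnum_neq0 Hp k0)); rewrite mulr0.
  case: k k0 => // k _; rewrite En (qbinom_absorb _ _ _).1 -En.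
  by rewrite (prim_root_qnum0 Hn Hp) mul0r.
rewrite -[LHS]/(\sum_(k < n.+1) T k) big_ord_recr /=.
have -> : \sum_(k < n) T k = T 0%N.
  have -> : \sum_(k < n) T k = \sum_(k < m.+1) T k by rewrite -En.
  rewrite big_ord_recl big1 ?addr0 // => i _.
  by apply: T0; rewrite En /bump /= ltnS ltn_ord.
rewrite /T subnn taft_coef0 scale1r subn0 !expr0 mulr1 mul1r mulr1.
rewrite /taft_coef qbinomn mulr1 (prim_root_sign Hn Hp) scaleN1r.
by rewrite (prim_expr_order Hp) mulr1.
Qed.

(* The solution of the recursion with value E in degree 0, multiplied by (j)_q!. *)
Definition taft_closed (w : A) (E : K -> A) (j : nat) (y : K) : A :=
  q ^+ ((j * (j - 1)) %/ 2) *: taft_sum w E j (y * q ^+ j).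

Lemma taft_closed0 w E y : taft_closed w E 0 y = E y.
Proof. by rewrite /taft_closed taft_sum0 scale1r mulr1. Qed.

Lemma taft_closedS w E j y : q != 0 ->
  taft_closed w E j.+1 y
  = q ^+ j *: (w * taft_closed w E j (y * q)) - taft_closed w E j y * w.
Proof.
move=> q0; rewrite /taft_closed taft_sumS triangularS scalerBr.
rewrite exprSr mulrA mulfK // scalerA; congr (_ - _).
  by rewrite -scalerAr scalerA -exprD addnC (mulrAC y).
by rewrite -scalerAl exprD -mulrA -exprMn divff // expr1n mulr1.
Qed.

(** Without division by [(j)_q!] the formula also covers [j = n], the degree that yields centrality
    of [w ^+ n]. *)
Lemma taft_rec_closed w U : n.-primitive_root q -> taft_rec w U ->
  forall j y, y ^+ n = 1 -> qfact q j *: U j y = taft_closed w (U 0%N) j y.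
Proof.
move=> Hq recU; have q0 : q != 0 by rewrite (prim_root_eq0 Hq) -lt0n (prim_order_gt0 Hq).
elim=> [|j IH] y yn; first by rewrite taft_closed0 scale1r.
rewrite taft_closedS // -!IH ?exprMn ?yn ?(prim_expr_order Hq) ?mulr1 //.
rewrite /= mulrC -scalerA recU // scalerBr -scalerAl -scalerAr !scalerA.
by rewrite mulrC.
Qed.

Lemma closed_taft_rec w U : (2 <= n)%N -> n.-primitive_root q ->
  (forall b, w ^+ n * b = b * w ^+ n) ->
  (forall j y, (n <= j)%N -> U j y = 0) ->
  (forall j y, (j < n)%N -> y ^+ n = 1 -> qfact q j *: U j y = taft_closed w (U 0%N) j y) ->
  taft_rec w U.
Proof.
move=> Hn Hq wn U0 closedU k y yn.
have q0 : q != 0 by rewrite (prim_root_eq0 Hq) -lt0n (prim_order_gt0 Hq).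
have yqn : (y * q) ^+ n = 1 by rewrite exprMn yn mul1r (prim_expr_order Hq).
case: (ltnP k n) => [ltkn|lenk]; last first.
  by rewrite !U0 // 1?ltnW // !(scaler0, mulr0, mul0r) subr0.
apply: (scalerI (prim_root_qfact_neq0 Hq ltkn)).
rewrite scalerBr !scalerA (mulrC _ (q ^+ k)) -(scalerA (q ^+ k)).
rewrite (scalerAr (qfact q k) w) (scalerAl (qfact q k) _ w).
rewrite !closedU // -taft_closedS //.
have -> : qfact q k * qnum q k.+1 = qfact q k.+1 by rewrite mulrC.
(* At [k + 1 = n] the left side vanishes with [U n], and the closed form is a commutator with
   [w ^+ n], which vanishes by centrality. *)
case: (ltngtP k.+1 n) ltkn => // [ltkn _|En _]; first exact: closedU.
rewrite U0 ?En // scaler0 /taft_closed taft_sum_prim //.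
by rewrite wn subrr scaler0.
Qed.
End TaftRecursion.

(** * Fourier transform along the powers of g *)

Section Fourier.
Variables (K : fieldType) (A : algType K) (n : nat) (q : K).
Implicit Types X Y : {ffun 'I_n * 'I_n -> A}.

(** The degree is a natural number, so that degrees such as [l + k] need no bound; from [n] on the
    value is 0. *)
Definition fourier X (j : nat) (z : K) : A :=
  \sum_(u : 'I_n * 'I_n | u.2 == j :> nat) z ^+ u.1 *: X u.

Lemma fourier_large X j z : (n <= j)%N -> fourier X j z = 0.
Proof.
move=> lenj; rewrite /fourier big1 // => u /eqP Eu.
by move: (ltn_ord u.2); rewrite Eu ltnNge lenj.
Qed.

Lemma fourierE X (j : 'I_n) z : fourier X j z = \sum_(l < n) z ^+ l *: X (l, j).
Proof.
rewrite /fourier.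
rewrite (eq_big (fun u : 'I_n * 'I_n => xpredT u.1 && (u.2 == j))
  (fun u => z ^+ u.1 *: X (u.1, u.2))).
- rewrite -(pair_big_dep xpredT (fun _ m => m == j) (fun l m : 'I_n => z ^+ l *: X (l, m))) /=.
  by apply: eq_bigr => l _; rewrite big_pred1_eq.
- by case=> l m.
by case=> l m.
Qed.

Lemma fourier_lincomb (I : finType) (P : pred I) (c : I -> K)
    (X : I -> {ffun 'I_n * 'I_n -> A}) j z :
  fourier (\sum_(i | P i) c i *: X i) j z = \sum_(i | P i) c i *: fourier (X i) j z.
Proof.
rewrite /fourier; under [RHS]eq_bigr do rewrite scaler_sumr.
rewrite exchange_big; apply: eq_bigr => u _ /=.
rewrite sum_ffunE scaler_sumr; apply: eq_bigr => i _.
by rewrite ffunE !scalerA mulrC.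
Qed.

Hypothesis Hq : n.-primitive_root q.

(** The shift [s] only changes where the enumeration of the roots of unity starts; [s = j] matches
    the exponents [i + j] in (i). *)
Lemma fourier_inv X (l j : 'I_n) s :
  X (l, j) = n%:R^-1 *: \sum_(i < n) q ^+ (l * (i + s)) *: fourier X j (q^-1 ^+ (i + s)).
Proof.
have n0 := prim_root_natf_neq0 Hq.
have q0 : q != 0 by rewrite (prim_root_eq0 Hq) -lt0n (prim_order_gt0 Hq).
under eq_bigr do rewrite fourierE scaler_sumr.
rewrite exchange_big /= (bigD1 l) //= [X in _ + X]big1 => [|m neml].
  rewrite addr0; under eq_bigr => i _.
    rewrite scalerA [(l * _)%N]mulnC exprM -exprMn -exprMn divff // !expr1n scale1r; over.
  by rewrite sumr_const card_ord -scaler_nat scalerA mulVf // scale1r.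
under eq_bigr do rewrite scalerA.
rewrite -scaler_suml.
have -> : \sum_(i < n) q ^+ (l * (i + s)) * q^-1 ^+ (i + s) ^+ m
    = (q ^+ l / q ^+ m) ^+ s * \sum_(i < n) (q ^+ l / q ^+ m) ^+ i.
  rewrite mulr_sumr; apply: eq_bigr => i _.
  by rewrite -exprD addnC [RHS]exprMn (exprM q l) (exprAC (q^-1)) (exprVn q m).
rewrite sum_expr_unity_root; last first.
  by rewrite exprMn exprVn -!exprM !(mulnC _ n) !exprM (prim_expr_order Hq) !expr1n divr1.
rewrite ifF ?mulr0 ?scale0r //; apply: contraNF neml => /eqP.
move/(canRL (divfK (expf_neq0 m q0))); rewrite mul1r => /eqP.
by rewrite (eq_prim_root_expr Hq) !modn_small // eq_sym.
Qed.

Lemma fourier_inj X Y :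
  (forall (j : 'I_n) z, z ^+ n = 1 -> fourier X j z = fourier Y j z) -> X = Y.
Proof.
move=> eqXY; apply/ffunP => -[l j]; rewrite (fourier_inv X l j 0) (fourier_inv Y l j 0).
congr (_ *: _); apply: eq_bigr => i _; rewrite eqXY //.
by rewrite addn0 exprVn -!exprVn exprAC exprVn (prim_expr_order Hq) invr1 expr1n.
Qed.

Lemma fourier_synthesis X (j : 'I_n) s (G : K -> A) :
  (forall l, X (l, j)
     = n%:R^-1 *: \sum_(i < n) q ^+ (l * (i + s)) *: G (q^-1 ^+ (i + s))) ->
  forall z, z ^+ n = 1 -> fourier X j z = G z.
Proof.
move=> defX z zn; have n0 := prim_root_natf_neq0 Hq.
have q0 : q != 0 by rewrite (prim_root_eq0 Hq) -lt0n (prim_order_gt0 Hq).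
have qin i : (z * q ^+ i) ^+ n = 1.
  by rewrite exprMn zn exprAC (prim_expr_order Hq) expr1n mulr1.
(* The inner sum is [n] when [z = q^-(i+s)] and 0 otherwise. Exchanging the sums gives the total
   without exhibiting the one [i] that contributes. *)
have En : \sum_(i < n) \sum_(l < n) (z * q ^+ (i + s)) ^+ l = n%:R.
  rewrite exchange_big /=.
  have n_gt0 := prim_order_gt0 Hq.
  rewrite (bigD1 (Ordinal n_gt0)) //= [X in _ + X]big1 ?addr0 => [|l neml].
    by rewrite sumr_const card_ord.
  have -> : \sum_(i < n) (z * q ^+ (i + s)) ^+ l
      = (z * q ^+ s) ^+ l * \sum_(i < n) (q ^+ l) ^+ i.
    by rewrite mulr_sumr; apply: eq_bigr => i _;
       rewrite (exprAC _ l) -exprMn addnC exprD mulrA.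
  rewrite sum_expr_unity_root; last by rewrite exprAC (prim_expr_order Hq) expr1n.
  rewrite ifF ?mulr0 // -(prim_order_dvd Hq) gtnNdvd //.
  by rewrite lt0n; apply: contra neml.
rewrite fourierE.
under eq_bigr do rewrite defX scalerA scaler_sumr.
rewrite exchange_big /=.
transitivity (\sum_(i < n) n%:R^-1 *: (\sum_(l < n) (z * q ^+ (i + s)) ^+ l *: G z)).
  apply: eq_bigr => i _; under eq_bigr do
    rewrite scalerA -mulrA [n%:R^-1 * _]mulrC mulrA -[_ * n%:R^-1]mulrC -scalerA
      mulnC exprM -exprMn.
  rewrite -scaler_sumr -!scaler_suml sum_expr_unity_root //.
  case: eqP => [E|]; last by rewrite !scale0r.
  suff -> : q^-1 ^+ (i + s) = z by [].
  by rewrite exprVn -[RHS](mulfK (expf_neq0 (i + s) q0)) E mul1r.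
by rewrite -scaler_sumr; under eq_bigr do rewrite -scaler_suml;
   rewrite -scaler_suml En scalerA mulVf // scale1r.
Qed.

(** Moving [x^i] past [g^b] costs [q^(i b)], and [z^(a+b) q^(i b) = z^a (z q^i)^b]. Reducing [a + b]
    mod [n] is harmless since [z ^+ n = 1]. *)
Lemma fourier_tens_mul X Y (j : 'I_n) z : z ^+ n = 1 ->
  fourier (tens_mul (@taft_mulc K n q) X Y) j z
  = \sum_(i < j.+1) fourier X i z * fourier Y (j - i) (z * q ^+ i).
Proof.
move=> zn.
transitivity (\sum_(v : 'I_n * 'I_n) \sum_(w : 'I_n * 'I_n)
    (if (v.2 + w.2)%N == j :> nat then z ^+ (v.1 + w.1) * q ^+ (v.2 * w.1) else 0)
       *: (X v * Y w)).
  rewrite /fourier; under eq_bigr do rewrite ffunE scaler_sumr.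
  rewrite exchange_big; apply: eq_bigr => v _ /=.
  under eq_bigr do rewrite scaler_sumr.
  rewrite exchange_big; apply: eq_bigr => w _ /=.
  under eq_bigr do rewrite scalerA.
  rewrite -scaler_suml; congr (_ *: _).
  have n_gt0 := prim_order_gt0 Hq.
  pose l := Ordinal (ltn_pmod (v.1 + w.1) n_gt0).
  rewrite (bigD1 (l, j)) //= big1 => [|[s1 s2] /andP[/= /eqP Es2 nes]].
    rewrite addr0 /taft_mulc /= eqxx /=.
    by case: eqP => _; rewrite ?mulr0 // (expr_mod _ zn).
  rewrite /taft_mulc /=; case: ifP; rewrite ?mulr0 // => /andP[/eqP E1 _].
  case/negP: nes; apply/eqP; congr (_, _); exact: val_inj.
under [RHS]eq_bigr do rewrite /fourier mulr_suml big_mkcond /=.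
rewrite [RHS]exchange_big; apply: eq_bigr => v _ /=.
transitivity (\sum_(i < j.+1 | v.2 == i :> nat)
   \sum_(w : 'I_n * 'I_n | w.2 == (j - i)%N :> nat)
      (z ^+ (v.1 + w.1) * q ^+ (v.2 * w.1)) *: (X v * Y w)); last first.
  rewrite [LHS]big_mkcond; apply: eq_bigr => i _; case: eqP => // Ei.
  rewrite mulr_sumr; apply: eq_bigr => w _.
  by rewrite -scalerAl -scalerAr scalerA exprMn -exprM exprD mulrA Ei.
case: (leqP v.2 j) => [levj|ltjv].
  have ltvj : (v.2 < j.+1)%N by [].
  rewrite (big_pred1 (Ordinal ltvj)) /= => [|i]; last by rewrite eq_sym.
  rewrite [RHS]big_mkcond; apply: eq_bigr => w _.
  have -> : (w.2 == (j - v.2)%N :> nat) = ((v.2 + w.2)%N == j :> nat).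
    by rewrite -(eqn_add2l v.2) subnKC.
  by case: eqP => _; rewrite ?scale0r.
rewrite !big1 // => [i /eqP Ei|w _]; first by move: (ltn_ord i); rewrite -Ei ltnS leqNgt ltjv.
case: eqP => [E|]; last by rewrite scale0r.
by move: ltjv; rewrite -E ltnNge leq_addr.
Qed.
End Fourier.

(** * Partial coactions in terms of the operators D_j(z) *)

Section TaftCoactions.
Variables (K : fieldType) (A : algType K) (n : nat) (q : K).
Variable rho : {linear A -> {ffun 'I_n * 'I_n -> A}}.

(* The operator D_j(z). *)
Definition taft_act (j : nat) (z : K) (a : A) : A := fourier (rho a) j z.

Lemma taft_act_lincomb (I : finType) (P : pred I) (c : I -> K) (b : I -> A) j z :
  taft_act j z (\sum_(i | P i) c i *: b i) = \sum_(i | P i) c i *: taft_act j z (b i).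
Proof.
rewrite /taft_act linear_sum; under eq_bigr do rewrite linearZ.
exact: fourier_lincomb.
Qed.

Lemma taft_act0 j z : taft_act j z 0 = 0.
Proof. by rewrite /taft_act linear0 /fourier big1 // => u _; rewrite ffunE scaler0. Qed.

Lemma taft_actB j z a b : taft_act j z (a - b) = taft_act j z a - taft_act j z b.
Proof.
rewrite /taft_act linearB /fourier -sumrB; apply: eq_bigr => u _.
by rewrite !ffunE scalerBr.
Qed.

Lemma taft_actZ j z c a : taft_act j z (c *: a) = c *: taft_act j z a.
Proof.
rewrite /taft_act linearZ /fourier scaler_sumr; apply: eq_bigr => u _.
by rewrite !ffunE !scalerA mulrC.
Qed.

Lemma taft_act_large j z a : (n <= j)%N -> taft_act j z a = 0.
Proof. exact: fourier_large. Qed.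

Definition taft_act_mulr := forall (j : 'I_n) z a b, z ^+ n = 1 ->
  taft_act j z (a * b)
  = \sum_(i < j.+1) taft_act i z a * taft_act (j - i) (z * q ^+ i) b.

Definition taft_act_act := forall (j : 'I_n) (k : nat) z y a, z ^+ n = 1 -> y ^+ n = 1 ->
  taft_act j z (taft_act k y a)
  = \sum_(i < j.+1) taft_act i z 1
      * (((z * q ^+ i) ^+ k * qbinom q (j - i + k) k)
           *: taft_act (j - i + k) (y * (z * q ^+ i)) a).

Hypothesis Hq : n.-primitive_root q.

(** Degrees [l] and [k] in the two legs of the coproduct select the [g^i x^(l+k)], whose first leg
    has [g^(i+k)]; the weight is [x^(i+k) y^i = x^k (y x)^i]. *)
Lemma taft_copc_fourier (a : A) (k l : nat) (y x : K) : x ^+ n = 1 ->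
  \sum_(t : 'I_n * 'I_n | t.2 == k :> nat) y ^+ t.1 *:
     fourier [ffun s => \sum_u taft_copc q u s t *: rho a u] l x
  = (x ^+ k * qbinom q (l + k) k) *: taft_act (l + k) (y * x) a.
Proof.
move=> xn; rewrite /taft_act /fourier scaler_sumr.
transitivity (\sum_(t : 'I_n * 'I_n | t.2 == k :> nat) \sum_(u : 'I_n * 'I_n)
   (y ^+ t.1 * (if [&& t.1 == u.1 :> nat & u.2 == (l + k)%N :> nat]
                then x ^+ (u.1 + k) * qbinom q (l + k) k else 0)) *: rho a u).
  apply: eq_bigr => t /eqP Et; rewrite scaler_sumr.
  under eq_bigr do rewrite ffunE !scaler_sumr.
  rewrite exchange_big; apply: eq_bigr => u _ /=.
  under eq_bigr do rewrite !scalerA.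
  rewrite -scaler_suml; congr (_ *: _); under eq_bigr do rewrite -mulrA.
  rewrite -mulr_sumr; congr (_ * _); rewrite /taft_copc Et.
  have n_gt0 := prim_order_gt0 Hq.
  case: eqP => [E1|] /=; last by move=> _; rewrite big1 // => s _; rewrite mulr0.
  case: eqP => [E2|E2]; last first.
    rewrite big1 // => s /eqP Es; case: ifP; rewrite ?mulr0 // => /and3P[leku /eqP Es2 _].
    by case: E2; rewrite -Es Es2 subnK.
  have ltln : (l < n)%N by apply: leq_ltn_trans (ltn_ord u.2); rewrite E2 leq_addr.
  rewrite (bigD1 (Ordinal (ltn_pmod (u.1 + k) n_gt0), Ordinal ltln)) //= big1.
    by rewrite E2 leq_addl addnK !eqxx /= (expr_mod _ xn) addr0.
  move=> [s1 s2] /andP[/= /eqP Es2 nes]; case: ifP; rewrite ?mulr0 // => /and3P[_ _ /eqP Es1].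
  case/negP: nes; apply/eqP; congr (_, _); exact: val_inj.
rewrite exchange_big /= [RHS]big_mkcond; apply: eq_bigr => u _.
case: (ltnP k n) => [ltkn|lenk]; last first.
  rewrite big1 => [|t /eqP Et]; last by move: (ltn_ord t.2); rewrite Et ltnNge lenk.
  case: eqP => // Eu; have := ltn_ord u.2.
  by rewrite Eu ltnNge (leq_trans lenk) ?leq_addl.
rewrite (bigD1 (u.1, Ordinal ltkn)) //= big1 ?addr0 => [|[t1 t2] /andP[/= /eqP Et2 net]].
  rewrite eqxx /=; case: eqP => _; rewrite ?mulr0 ?scale0r // scalerA exprD exprMn.
  by congr (_ *: _); ring.
case: ifP; rewrite ?mulr0 ?scale0r // => /andP[/eqP Et1 _].
by case/negP: net; apply/eqP; congr (_, _); exact: val_inj.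
Qed.

Lemma taft_partial_coactionP :
  is_partial_coaction (@taft_mulc K n q) (@taft_copc K n q) (@taft_epsc K n) rho
  <-> [/\ forall a, taft_act 0 1 a = a, taft_act_mulr & taft_act_act].
Proof.
have counit a : taft_act 0 1 a = \sum_(u : 'I_n * 'I_n) taft_epsc K u *: rho a u.
  rewrite /taft_act /fourier big_mkcond; apply: eq_bigr => u _.
  by rewrite /taft_epsc expr1n; case: eqP => _; rewrite ?scale0r.
pose R a t := tens_mul (@taft_mulc K n q) (rho 1)
   [ffun s => \sum_(u : 'I_n * 'I_n) taft_copc q u s t *: rho a u].
have defR a s t : \sum_(v : 'I_n * 'I_n) \sum_(s' : 'I_n * 'I_n) taft_mulc q v s' s *:
     (rho 1 v * \sum_u taft_copc q u s' t *: rho a u) = R a t s.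
  rewrite ffunE; apply: eq_bigr => v _; apply: eq_bigr => w _.
  by rewrite ffunE.
have actR (j : 'I_n) k z y a : z ^+ n = 1 ->
  \sum_(t : 'I_n * 'I_n | t.2 == k :> nat) y ^+ t.1 *: fourier (R a t) j z
  = \sum_(i < j.+1) taft_act i z 1
      * (((z * q ^+ i) ^+ k * qbinom q (j - i + k) k)
           *: taft_act (j - i + k) (y * (z * q ^+ i)) a).
  move=> zn; under eq_bigr do rewrite fourier_tens_mul // scaler_sumr.
  rewrite exchange_big; apply: eq_bigr => i _ /=.
  under eq_bigr do rewrite scalerAr.
  rewrite -mulr_sumr taft_copc_fourier //.
  by rewrite exprMn zn exprAC (prim_expr_order Hq) expr1n mulr1.
have actact j k z y a : taft_act j z (taft_act k y a) =
  \sum_(t : 'I_n * 'I_n | t.2 == k :> nat) y ^+ t.1 *: fourier (rho (rho a t)) j z.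
  by rewrite {2}/taft_act /fourier taft_act_lincomb.
split=> [[eps mul act]|[eps mul act]]; split.
- by move=> a; rewrite counit eps.
- by move=> j z a b zn; rewrite /taft_act mul fourier_tens_mul.
- move=> j k z y a zn yn; rewrite actact -actR //; apply: eq_bigr => t _.
  by congr (_ *: fourier _ _ _); apply/ffunP => s; rewrite act defR.
- by move=> a; rewrite -counit eps.
- move=> a b; apply: (fourier_inj Hq) => j z zn.
  by rewrite fourier_tens_mul // -[LHS]/(taft_act j z (a * b)) mul.
move=> a s t; rewrite defR; suff -> : rho (rho a t) = R a t by [].
apply: (fourier_inj Hq) => j z zn.
(* The first tensor leg is settled; [X] and [Y] collect the coefficients over the second leg [t], to
   which inversion is applied again. *)
pose X : {ffun 'I_n * 'I_n -> A} := [ffun t => fourier (rho (rho a t)) j z].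
pose Y : {ffun 'I_n * 'I_n -> A} := [ffun t => fourier (R a t) j z].
suff /ffunP/(_ t) : X = Y by rewrite !ffunE.
apply: (fourier_inj Hq) => k y yn; rewrite /fourier.
under eq_bigr do rewrite ffunE; under [RHS]eq_bigr do rewrite ffunE.
by rewrite -actact actR // act.
Qed.
End TaftCoactions.

(** * Partial coactions of the group algebra by the same transform *)

Section GroupCoactions.
Variables (K : fieldType) (A : algType K) (n : nat) (q : K).
Hypothesis Hq : n.-primitive_root q.

Definition grp_fourier (X : {ffun 'I_n -> A}) (z : K) : A :=
  \sum_(i < n) z ^+ i *: X i.

Lemma grp_fourier_inj X Y :
  (forall z, z ^+ n = 1 -> grp_fourier X z = grp_fourier Y z) -> X = Y.
Proof.
(* Families constant in the second index reduce this to the inversion already proved. *)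
move=> eqXY; pose ext (Z : {ffun 'I_n -> A}) : {ffun 'I_n * 'I_n -> A} := [ffun u => Z u.1].
suff /ffunP eqXY' : ext X = ext Y.
  by apply/ffunP => i; have := eqXY' (i, i); rewrite !ffunE.
apply: (fourier_inj Hq) => j z zn; rewrite !fourierE.
under eq_bigr do rewrite ffunE; under [RHS]eq_bigr do rewrite ffunE.
exact: eqXY.
Qed.

Lemma grp_fourier_tens_mul (X Y : {ffun 'I_n -> A}) z : z ^+ n = 1 ->
  grp_fourier (tens_mul (@grp_mulc K n) X Y) z = grp_fourier X z * grp_fourier Y z.
Proof.
move=> zn; rewrite /grp_fourier mulr_suml.
under eq_bigr do rewrite ffunE scaler_sumr.
rewrite exchange_big; apply: eq_bigr => v _ /=.
under eq_bigr do rewrite scaler_sumr.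
rewrite exchange_big mulr_sumr; apply: eq_bigr => w _ /=.
have n_gt0 := prim_order_gt0 Hq.
rewrite (bigD1 (Ordinal (ltn_pmod (v + w) n_gt0))) //= big1 => [|s nes].
  by rewrite addr0 /grp_mulc /= eqxx scale1r (expr_mod _ zn) -scalerAl -scalerAr scalerA exprD.
rewrite /grp_mulc; case: eqP => [E|]; rewrite ?scale0r ?scaler0 //.
by case/negP: nes; apply/eqP/val_inj; rewrite /= E.
Qed.

Variable rho : {linear A -> {ffun 'I_n * 'I_n -> A}}.

Lemma sum_first_index (c : 'I_n -> K) (X : {ffun 'I_n * 'I_n -> A}) (j : nat) :
  \sum_(t < n) c t *: \sum_(u : 'I_n * 'I_n | (u.1 == t) && (u.2 == j :> nat)) X u
  = \sum_(u : 'I_n * 'I_n | u.2 == j :> nat) c u.1 *: X u.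
Proof.
rewrite (partition_big fst xpredT) //=; apply: eq_bigr => t _.
rewrite scaler_sumr; apply: eq_big => [u|u /andP[/eqP -> _] //].
by rewrite andbC.
Qed.

Lemma grp_fourier_proj z a : grp_fourier (proj_rho rho a) z = taft_act rho 0 z a.
Proof.
rewrite /grp_fourier; under eq_bigr do rewrite ffunE.
exact: (sum_first_index (fun i => z ^+ i)).
Qed.

Lemma PcompE m a : Pcomp q rho m a = taft_act rho 0 (q^-1 ^+ m) a.
Proof.
rewrite /Pcomp (sum_first_index (fun t => q^-1 ^+ (m * t))).
by apply: eq_bigr => u _; rewrite exprM.
Qed.

Lemma welE : wel q rho = taft_act rho 1 q^-1 1.
Proof. exact: (sum_first_index (fun t => q^-1 ^+ t)). Qed.

Lemma grp_partial_coactionP :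
  is_partial_coaction (@grp_mulc K n) (@grp_copc K n) (@grp_epsc K n) (proj_rho rho)
  <-> [/\ forall a, taft_act rho 0 1 a = a,
       forall z a b, z ^+ n = 1 ->
         taft_act rho 0 z (a * b) = taft_act rho 0 z a * taft_act rho 0 z b
     & forall z y a, z ^+ n = 1 -> y ^+ n = 1 ->
         taft_act rho 0 z (taft_act rho 0 y a)
         = taft_act rho 0 z 1 * taft_act rho 0 (y * z) a].
Proof.
have counit a : taft_act rho 0 1 a = \sum_(i < n) grp_epsc K i *: proj_rho rho a i.
  by rewrite -grp_fourier_proj; apply: eq_bigr => i _; rewrite expr1n.
pose S a t : {ffun 'I_n -> A} := [ffun s => \sum_(u < n) grp_copc K u s t *: proj_rho rho a u].
pose R a t := tens_mul (@grp_mulc K n) (proj_rho rho 1) (S a t).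
have defR a s t : \sum_(v < n) \sum_(s' < n) grp_mulc K v s' s *:
     (proj_rho rho 1 v * \sum_u grp_copc K u s' t *: proj_rho rho a u) = R a t s.
  rewrite /R [RHS]ffunE; apply: eq_bigr => v _; apply: eq_bigr => w _.
  by rewrite [S _ _ _]ffunE.
have fourierS a t z : grp_fourier (S a t) z = z ^+ t *: proj_rho rho a t.
  rewrite /grp_fourier (bigD1 t) //= big1 ?addr0 => [|s nest].
    rewrite ffunE (bigD1 t) //= big1 ?addr0 => [|u neut].
      by rewrite /grp_copc eqxx scale1r.
    by rewrite /grp_copc eq_sym (negbTE neut) scale0r.
  rewrite ffunE big1 ?scaler0 // => u _; rewrite /grp_copc.
  case: ifP; rewrite ?scale0r // => /andP[/eqP Es /eqP Et].
  by case/negP: nest; rewrite Es Et.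
have actR z y a : z ^+ n = 1 ->
  \sum_(t < n) y ^+ t *: grp_fourier (R a t) z
  = taft_act rho 0 z 1 * taft_act rho 0 (y * z) a.
  move=> zn; rewrite -!grp_fourier_proj {2}/grp_fourier mulr_sumr.
  apply: eq_bigr => t _; rewrite grp_fourier_tens_mul // fourierS.
  by rewrite scalerAr scalerA exprMn.
have actact z y a : taft_act rho 0 z (taft_act rho 0 y a) =
  \sum_(t < n) y ^+ t *: grp_fourier (proj_rho rho (proj_rho rho a t)) z.
  rewrite -(grp_fourier_proj y) /grp_fourier taft_act_lincomb.
  by apply: eq_bigr => t _; rewrite -grp_fourier_proj.
split=> [[eps mul act]|[eps mul act]]; split.
- by move=> a; rewrite counit eps.
- by move=> z a b zn; rewrite -!grp_fourier_proj mul grp_fourier_tens_mul.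
- move=> z y a zn yn; rewrite actact -actR //; apply: eq_bigr => t _.
  by congr (_ *: grp_fourier _ _); apply/ffunP => s; rewrite act defR.
- by move=> a; rewrite -counit eps.
- move=> a b; apply: grp_fourier_inj => z zn.
  by rewrite grp_fourier_tens_mul // !grp_fourier_proj mul.
move=> a s t; rewrite defR; suff -> : proj_rho rho (proj_rho rho a t) = R a t by [].
apply: grp_fourier_inj => z zn.
pose X : {ffun 'I_n -> A} := [ffun t => grp_fourier (proj_rho rho (proj_rho rho a t)) z].
pose Y : {ffun 'I_n -> A} := [ffun t => grp_fourier (R a t) z].
suff /ffunP/(_ t) : X = Y by rewrite !ffunE.
apply: grp_fourier_inj => y yn; rewrite /grp_fourier.
under eq_bigr do rewrite ffunE; under [RHS]eq_bigr do rewrite ffunE.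
by rewrite -actact actR // act.
Qed.
End GroupCoactions.

(** * The two implications *)

Section TaftPartialCoactions.
Variables (K : fieldType) (A : algType K) (n : nat) (q : K).
Hypotheses (Hn : (2 <= n)%N) (Hq : n.-primitive_root q).
Variable rho : {linear A -> {ffun 'I_n * 'I_n -> A}}.
Local Notation p := (q^-1).
Local Notation D := (taft_act rho).
Local Notation w := (D 1 p 1).
Local Notation tpc :=
  (is_partial_coaction (@taft_mulc K n q) (@taft_copc K n q) (@taft_epsc K n) rho).

Lemma prim_root_unit : q != 0.
Proof. by rewrite (prim_root_eq0 Hq) -lt0n (prim_order_gt0 Hq). Qed.

Lemma unity_root_neq0 (z : K) : z ^+ n = 1 -> z != 0.
Proof.
move=> zn; apply: contra_eq_neq zn => ->.
by rewrite expr0n gtn_eqF ?(ltnW Hn) // eq_sym oner_neq0.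
Qed.

Lemma prim_root_inv_expn : p ^+ n = 1.
Proof. by rewrite exprVn (prim_expr_order Hq) invr1. Qed.

(** Every [D 0 z 1 * b] equals [D 0 z (D 0 z^-1 b)], and [D 0 z 1] is a right unit on the image of
    the multiplicative map [D 0 z]. *)
Lemma taft_act0_idem :
  (forall a, D 0 1 a = a) ->
  (forall z a b, z ^+ n = 1 -> D 0 z (a * b) = D 0 z a * D 0 z b) ->
  (forall z y a, z ^+ n = 1 -> y ^+ n = 1 ->
     D 0 z (D 0 y a) = D 0 z 1 * D 0 (y * z) a) ->
  forall z b, z ^+ n = 1 -> D 0 z 1 * b * D 0 z 1 = D 0 z 1 * b.
Proof.
move=> D01 D0M D0D z b zn.
have zVn : z^-1 ^+ n = 1 by rewrite exprVn zn invr1.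
have E : D 0 z (D 0 z^-1 b) = D 0 z 1 * b.
  by rewrite D0D // mulVf ?unity_root_neq0 // D01.
by rewrite -E -D0M // mulr1.
Qed.

(** * Necessity: what the axioms force on the operators *)

Section Forward.
Hypothesis Hrho : tpc.

Let o0 : 'I_n := Ordinal (ltnW Hn).
Let o1 : 'I_n := Ordinal Hn.

Lemma taft_act_counit a : D 0 1 a = a.
Proof. by have [] := (taft_partial_coactionP rho Hq).1 Hrho. Qed.

Lemma taft_act0_mul z a b : z ^+ n = 1 -> D 0 z (a * b) = D 0 z a * D 0 z b.
Proof.
move=> zn; have [_ mul _] := (taft_partial_coactionP rho Hq).1 Hrho.
by rewrite (mul o0) // big_ord1 mulr1.
Qed.

Lemma taft_act0_act k z y a : z ^+ n = 1 -> y ^+ n = 1 ->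
  D 0 z (D k y a) = z ^+ k *: (D 0 z 1 * D k (y * z) a).
Proof.
move=> zn yn; have [_ _ act] := (taft_partial_coactionP rho Hq).1 Hrho.
by rewrite (act o0) // big_ord1 mulr1 add0n qbinomn mulr1 scalerAr.
Qed.

Lemma taft_act1_mul z a b : z ^+ n = 1 ->
  D 1 z (a * b) = D 0 z a * D 1 z b + D 1 z a * D 0 (z * q) b.
Proof.
move=> zn; have [_ mul _] := (taft_partial_coactionP rho Hq).1 Hrho.
by rewrite (mul o1) // big_ord_recl big_ord1 mulr1.
Qed.

Lemma taft_act1_act k z y a : z ^+ n = 1 -> y ^+ n = 1 ->
  D 1 z (D k y a) = (z ^+ k * qnum q k.+1) *: (D 0 z 1 * D k.+1 (y * z) a)
    + (z * q) ^+ k *: (D 1 z 1 * D k (y * (z * q)) a).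
Proof.
move=> zn yn; have [_ _ act] := (taft_partial_coactionP rho Hq).1 Hrho.
have -> : D 1 z (D k y a) =
    D 0 z 1 * (((z * q ^+ 0) ^+ k * qbinom q (1 + k) k) *: D (1 + k) (y * (z * q ^+ 0)) a)
    + D 1 z 1 * (((z * q ^+ 1) ^+ k * qbinom q (0 + k) k) *: D (0 + k) (y * (z * q ^+ 1)) a).
  by rewrite (act o1) // big_ord_recl big_ord1.
rewrite !mulr1 add0n qbinomn mulr1 add1n expr1.
suff -> : qbinom q k.+1 k = qnum q k.+1 by rewrite -!scalerAr.
have := (qbinom_absorb q k k).2 (leqnn k).
by rewrite subSnn qbinomn mulr1 /qnum big_ord1 mul1r.
Qed.

Lemma taft_act_global : D 0 p 1 = 1 -> rho 1 = tensor 1 [ffun u => @taft_unitc K n u].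
Proof.
move=> D1; have q0 := prim_root_unit; have pn := prim_root_inv_expn.
have D0 z : z ^+ n = 1 -> D 0 z 1 = 1.
  move=> zn; have [i ->] := prim_rootP (prim_root_inv Hn Hq) zn.
  elim: (i : nat) => [|m IH]; first by rewrite taft_act_counit.
  have := @taft_act0_act 0 p (p ^+ m) 1 pn.
  by rewrite IH D1 mul1r scale1r exprSr => <- //; rewrite exprAC pn expr1n.
(* Expanding [D 1 p (1 * 1)] gives [w = w + w]. *)
have w0 : w = 0.
  have := taft_act1_mul 1 1 pn; rewrite mulr1 D1 mul1r (mulVf q0) taft_act_counit mulr1.
  by move=> /(canLR (addrK _)); rewrite subrr => /esym.
(* Apply [D 1 p] to [D k (y * q) 1]: the result is 0, the term in [w] drops out, and a nonzero
   multiple of [D k.+1 y 1] is left. *)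
have DS k y : (k.+1 < n)%N -> y ^+ n = 1 -> D k.+1 y 1 = 0.
  elim: k y => [|k IH] y ltkn yn.
    have yqn : (y * q) ^+ n = 1 by rewrite exprMn yn (prim_expr_order Hq) mulr1.
    have := @taft_act1_act 0 p (y * q) 1 pn yqn.
    rewrite D0 // w0 D1 mul0r scaler0 addr0 mulfK // /qnum big_ord1 mulr1 scale1r mul1r.
    by move=> <-.
  have yqn : (y * q) ^+ n = 1 by rewrite exprMn yn (prim_expr_order Hq) mulr1.
  have := @taft_act1_act k.+1 p (y * q) 1 pn yqn.
  rewrite IH ?(ltnW ltkn) // taft_act0 D1 w0 mul0r scaler0 addr0 mulfK // mul1r.
  move/esym/eqP; rewrite scaler_eq0 mulf_eq0 expf_eq0 invr_eq0 (negbTE q0) andbF /=.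
  by rewrite (negbTE (prim_root_qnum_neq0 Hq _)) ?ltkn // => /eqP.
apply: (fourier_inj Hq) => j z zn; rewrite -[LHS]/(D j z 1).
have -> : fourier (tensor 1 [ffun u => @taft_unitc K n u]) j z
    = (if j == 0%N :> nat then 1 else 0 : A).
  rewrite fourierE (bigD1 o0) //= !ffunE /taft_unitc /= big1 => [|l nel].
    by rewrite addr0 scale1r; case: eqP; rewrite ?scale1r ?scale0r.
  by rewrite !ffunE /=; case: eqP => [E|_]; rewrite ?scale0r ?scaler0 //;
     case/negP: nel; apply/eqP/val_inj.
case: j => [[|j] ltjn] /=; [exact: D0 | exact: DS].
Qed.

Hypothesis A1_0 : D 0 p 1 = 0.

(** Coassociativity for [D 1 1] after [D k y] becomes the recursion once [D 1 1] is recognised as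
    right multiplication by [- w]. *)
Lemma taft_act_rec a : taft_rec n q w (fun j y => D j y a).
Proof.
have q0 := prim_root_unit; have pn := prim_root_inv_expn.
have qn := prim_expr_order Hq; have one_n := expr1n K n.
(* Since [p * q = 1], [D 0 q] maps [D 0 p 1 = 0] to [D 0 q 1 * D 0 1 1]. *)
have Dq : D 0 q 1 = 0.
  have := @taft_act0_act 0 q p 1 qn pn.
  by rewrite A1_0 taft_act0 mulVf // taft_act_counit mulr1 scale1r => <-.
have D11 b : D 1 1 b = b * D 1 1 1.
  by rewrite -{1}[b]mulr1 taft_act1_mul // taft_act_counit mul1r Dq mulr0 addr0.
have step k y b : y ^+ n = 1 ->
  D k y b * D 1 1 1 = qnum q k.+1 *: D k.+1 y b + q ^+ k *: (D 1 1 1 * D k (y * q) b).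
  move=> yn; rewrite -D11 taft_act1_act // expr1n mul1r taft_act_counit mul1r mulr1.
  by rewrite mul1r.
(* This is [step] in degree 0 at [y = p], [b = 1], where [D 0 p 1 = 0] and [D 0 (p * q) 1 = 1]. *)
have Ew : D 1 1 1 = - w.
  have := step 0%N p 1 pn; rewrite A1_0 mul0r mulVf // taft_act_counit mulr1.
  rewrite /qnum big_ord1 !scale1r => /esym/eqP.
  by rewrite addr_eq0 => /eqP ->; rewrite opprK.
move=> k y yn; have := step k y a yn; rewrite Ew mulrN mulNr scalerN.
by move/eqP; rewrite eq_sym subr_eq => /eqP ->; rewrite addrC.
Qed.

(** Expand [D 1 (p * z) 1] by the recursion and multiply by [D 0 z 1] on the left: idempotence
    simplifies one term, and the other contains [D 0 z (D 0 p 1) = 0]. *)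
Lemma taft_act0_wel z : z ^+ n = 1 -> D 0 z w = z *: (D 0 z 1 * w).
Proof.
move=> zn; have pn := prim_root_inv_expn; have q0 := prim_root_unit.
have z0 := unity_root_neq0 zn.
have pzn : (p * z) ^+ n = 1 by rewrite exprMn pn zn mulr1.
have idem b : D 0 z 1 * b * D 0 z 1 = D 0 z 1 * b.
  apply: taft_act0_idem zn => [a|x a c xn|x y a xn yn].
  - exact: taft_act_counit.
  - exact: taft_act0_mul.
  by rewrite taft_act0_act // scale1r.
rewrite taft_act0_act // expr1; congr (_ *: _).
have := @taft_act_rec 1 0%N _ pzn; rewrite /qnum big_ord1 !scale1r => ->.
rewrite mulrAC mulVf // mul1r mulrBr !mulrA idem.
have := @taft_act0_act 0 z p 1 zn pn; rewrite A1_0 taft_act0 scale1r => <-.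
by rewrite mul0r subr0.
Qed.
End Forward.

(** * Sufficiency: from the recursion back to the axioms *)

Section Backward.
Hypothesis D01 : forall a, D 0 1 a = a.
Hypothesis D0M : forall z a b, z ^+ n = 1 -> D 0 z (a * b) = D 0 z a * D 0 z b.
Hypothesis D0D : forall z y a, z ^+ n = 1 -> y ^+ n = 1 ->
  D 0 z (D 0 y a) = D 0 z 1 * D 0 (y * z) a.
Variable v : A.
Hypothesis D0v : forall z, z ^+ n = 1 -> D 0 z v = z *: (D 0 z 1 * v).
Hypothesis Drec : forall a, taft_rec n q v (fun j y => D j y a).

(** Both sides satisfy the recursion with [D 0 z v] in place of [v], and they agree in degree 0 by
    the group axiom. *)
Lemma rec_taft_act0_act k z y a : z ^+ n = 1 -> y ^+ n = 1 ->
  D 0 z (D k y a) = D 0 z 1 * (z ^+ k *: D k (y * z) a).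
Proof.
move=> zn yn; have qn := prim_expr_order Hq.
case: (ltnP k n) => [ltkn|lenk]; last first.
  by rewrite !(taft_act_large _ _ _ lenk) taft_act0 scaler0 mulr0.
have z0 := unity_root_neq0 zn.
have idem b : D 0 z 1 * b * D 0 z 1 = D 0 z 1 * b by exact: taft_act0_idem.
apply: (taft_rec_inj (q := q) (w := D 0 z v) (U := fun k y => D 0 z (D k y a))
  (V := fun k y => D 0 z 1 * (z ^+ k *: D k (y * z) a))) ltkn yn => //.
- by move=> i i0; apply: (prim_root_qnum_neq0 Hq).
- by move=> i x xn; rewrite -taft_actZ Drec // taft_actB taft_actZ !D0M.
- move=> i x xn; have xzn : (x * z) ^+ n = 1 by rewrite exprMn xn zn mulr1.
  rewrite scalerAr scalerA (mulrC (qnum _ _)) -scalerA Drec // D0v // (mulrAC x q).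
  rewrite scalerBr mulrBr; congr (_ - _); rewrite -!scalerAr -!scalerAl !mulrA idem !scalerA.
    by congr (_ *: _); rewrite exprS; ring.
  by congr (_ *: _); rewrite exprS.
by move=> x xn; rewrite D0D // scale1r.
Qed.

Lemma rec_taft_partial_coaction : tpc.
Proof.
have qn := prim_expr_order Hq.
have qnz k : (0 < k < n)%N -> qnum q k != 0 by exact: (prim_root_qnum_neq0 Hq).
apply/(taft_partial_coactionP rho Hq); split=> //.
  move=> j z a b zn.
  apply: (taft_rec_inj qnz qn (Drec (a * b)) (taft_rec_conv qn (Drec a) (Drec b))) => //.
  by move=> y yn; rewrite big_ord1 mulr1 D0M.
move=> j k z y a zn yn.
pose V l x := (x ^+ k * qbinom q (l + k) k) *: D (l + k) (y * x) a.
(* Absorption turns [(l+1)_q] into [(l+k+1)_q]; the extra [q^k] in the recursion for [D (l + k)] is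
   supplied by [(x * q) ^+ k]. *)
have recV : taft_rec n q v V.
  move=> l x xn; rewrite /V.
  have absorb : qnum q l.+1 * qbinom q (l.+1 + k) k = qnum q (l + k).+1 * qbinom q (l + k) k.
    by have := (qbinom_absorb q (l + k) k).2 (leq_addl _ _); rewrite -addSn addnK.
  rewrite scalerA mulrCA absorb (mulrC (qnum _ _)) (mulrA y) (mulrA (x ^+ k)).
  rewrite -(scalerA _ (qnum _ _)) addSn Drec ?exprMn ?yn ?xn ?mulr1 //.
  rewrite scalerBr -!scalerAr -!scalerAl !scalerA mulrA.
  by congr (_ *: _ - _); rewrite exprD; ring.
apply: (taft_rec_inj qnz qn (Drec (D k y a)) (taft_rec_conv qn (Drec 1) recV)) => //.
by move=> x xn; rewrite big_ord1 mulr1 rec_taft_act0_act // /V qbinomn mulr1.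
Qed.
End Backward.
End TaftPartialCoactions.

(** * The expansion (i) as inverse transform of the closed solution *)

Section Expansion.
Variables (K : fieldType) (A : algType K) (n : nat) (q : K).
Hypothesis Hq : n.-primitive_root q.
Variable rho : {linear A -> {ffun 'I_n * 'I_n -> A}}.

Definition taft_expansion (w a : A) : {ffun 'I_n * 'I_n -> A} :=
  \sum_(i < n) \sum_(j < n) \sum_(0 <= k < j.+1)
    tensor
      (((q^-1) ^+ (i * j) * (-1) ^+ k * (q^-1) ^+ ((k * (k - 1)) %/ 2)
          * qbinom (q^-1) j k)
         *: (w ^+ (j - k) * @Pcomp K A n q rho (i + k) a * w ^+ k))
      (((n%:R)^-1 * (qfact q j)^-1 * q ^+ (i * j + (j * (j - 1)) %/ 2))
         *: \sum_(l < n) q ^+ (l * (i + j)) *: @taft_basis K n l j).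

Lemma taft_expansionE w a l m :
  taft_expansion w a (l, m) = n%:R^-1 *: \sum_(i < n) q ^+ (l * (i + m)) *:
    ((qfact q m)^-1 *: taft_closed q w (fun y => taft_act rho 0 y a) m (q^-1 ^+ (i + m))).
Proof.
have q0 : q != 0 := prim_root_unit Hq.
have basisE (i j : 'I_n) :
    (\sum_(l' < n) q ^+ (l' * (i + j)) *: @taft_basis K n l' j) (l, m)
    = if j == m then q ^+ (l * (i + j)) else 0.
  rewrite sum_ffunE (bigD1 l) //= big1 => [|l' nel].
    rewrite addr0 !ffunE xpair_eqE eqxx /= eq_sym.
    by case: eqP => _; rewrite /GRing.scale /= ?mulr1 ?mulr0.
  rewrite !ffunE xpair_eqE eq_sym (negbTE nel) /=.
  by rewrite /GRing.scale /= mulr0.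
have tensE (c : K) (h : {ffun 'I_n * 'I_n -> K^o}) (b : A) u :
    tensor b (c *: h) u = (c * h u) *: b by rewrite !ffunE.
have expE (i k : nat) : q^-1 ^+ (i + m) * q ^+ m * q^-1 ^+ k = q^-1 ^+ (i + k).
  by rewrite !exprD -(mulrA (_ ^+ i)) -exprMn mulVf // expr1n mulr1.
have cancE (i : nat) : q ^+ (i * m) * q^-1 ^+ (i * m) = 1 by rewrite -exprMn divff // expr1n.
rewrite /taft_expansion sum_ffunE scaler_sumr; apply: eq_bigr => i _.
rewrite sum_ffunE (bigD1 m) //= [X in _ + X]big1 ?addr0 => [|j nej].
  rewrite sum_ffunE big_mkord /taft_closed /taft_sum ![in RHS]scaler_sumr.
  apply: eq_bigr => k _; rewrite tensE basisE eqxx PcompE /taft_coef expE.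
  rewrite !scalerA (exprD q (i * m)); congr (_ *: _).
  transitivity (q ^+ (i * m) * q^-1 ^+ (i * m) * ((n%:R)^-1 * q ^+ (l * (i + m)) * (qfact q m)^-1
    * q ^+ ((m * (m - 1)) %/ 2) * ((-1) ^+ k * q^-1 ^+ ((k * (k - 1)) %/ 2) * qbinom q^-1 m k))).
    by ring.
  by rewrite cancE mul1r; ring.
rewrite sum_ffunE big1 // => k _.
by rewrite tensE basisE (negbTE nej) mulr0 scale0r.
Qed.

Lemma taft_rec_expansion w : (2 <= n)%N ->
  (forall a, taft_rec n q w (fun j y => taft_act rho j y a)) ->
  (forall a, taft_act rho 0 1 a = a) ->
  (forall a, rho a = taft_expansion w a) /\ (forall b, w ^+ n * b = b * w ^+ n).
Proof.
move=> Hn Drec D1; have pn : q^-1 ^+ n = 1 := prim_root_inv_expn Hq; split=> [a|b].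
  apply/ffunP => -[l m]; rewrite taft_expansionE (fourier_inv Hq _ l m m).
  congr (_ *: _); apply: eq_bigr => i _; congr (_ *: _).
  rewrite -(taft_rec_closed Hq (Drec a)); last by rewrite exprAC pn expr1n.
  by rewrite scalerA mulVf ?scale1r // (prim_root_qfact_neq0 Hq).
(* In degree [n] the operator is 0, so the closed form at [y = 1] says that [w ^+ n] commutes with
   [D 0 1 b = b]. *)
have := @taft_rec_closed _ _ _ _ _ _ Hq (Drec b) n 1 (expr1n _ _).
rewrite taft_act_large // scaler0 /taft_closed (prim_expr_order Hq) mulr1.
rewrite taft_sum_prim // D1 => /esym/eqP.
rewrite scaler_eq0 expf_eq0 (negbTE (prim_root_unit Hq)) andbF /= subr_eq0.
by move/eqP.
Qed.

Lemma expansion_taft_rec w : (2 <= n)%N -> (forall b, w ^+ n * b = b * w ^+ n) ->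
  (forall a, rho a = taft_expansion w a) ->
  forall a, taft_rec n q w (fun j y => taft_act rho j y a).
Proof.
move=> Hn wn Erho a; apply: (closed_taft_rec Hn Hq wn) => [j y lenj|j y ltjn yn].
  exact: taft_act_large.
(* The value that (i) prescribes for [D j y]; synthesis with shift [j] shows that it is attained at
   the roots of unity. *)
pose G y := (qfact q j)^-1 *: taft_closed q w (fun y => taft_act rho 0 y a) j y.
have := @fourier_synthesis _ _ _ _ Hq (rho a) (Ordinal ltjn) j G.
rewrite /taft_act /= => ->//; last by move=> l; rewrite {1}Erho taft_expansionE.
by rewrite scalerA divff ?scale1r // (prim_root_qfact_neq0 Hq).
Qed.
End Expansion.

Theorem theorem3p19 (K : fieldType) (A : algType K) (n : nat) (q : K)
  (Hn : (2 <= n)%N) (Hq : n.-primitive_root q)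
  (rho : {linear A -> {ffun 'I_n * 'I_n -> A}}) :
  let w := @wel K A n q rho in
  let Ai := @Acomp K A n q rho in
  (Ai 1%N = 0 \/ Ai 1%N = 1) ->
  (is_partial_coaction (@taft_mulc K n q) (@taft_copc K n q) (@taft_epsc K n) rho
   <->
   is_global_coaction (@taft_mulc K n q) (@taft_copc K n q) (@taft_epsc K n)
     (@taft_unitc K n) rho
   \/
   [/\ is_partial_coaction (@grp_mulc K n) (@grp_copc K n) (@grp_epsc K n)
         (@proj_rho K A n rho),
       Ai 1%N = 0,
       (forall a : A,
          rho a =
          \sum_(i < n) \sum_(j < n) \sum_(0 <= k < j.+1)
            tensor
              (((q^-1) ^+ (i * j) * (-1) ^+ k * (q^-1) ^+ ((k * (k - 1)) %/ 2)
                  * qbinom (q^-1) j k)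
                 *: (w ^+ (j - k) * @Pcomp K A n q rho (i + k) a * w ^+ k))
              (((n%:R)^-1 * (qfact q j)^-1 * q ^+ (i * j + (j * (j - 1)) %/ 2))
                 *: \sum_(l < n) q ^+ (l * (i + j)) *: @taft_basis K n l j)),
       (forall b : A, w ^+ n * b = b * w ^+ n) &
       (forall i : 'I_n,
          \sum_(s < n) (q^-1) ^+ (i * s) *:
             \sum_(u : 'I_n * 'I_n | (u.1 == s) && (u.2 == 0%N :> nat)) rho w u
          = q^-1 ^+ i *: (Ai i * w))]).
Proof.
move=> w Ai; have Ew : w = taft_act rho 1 q^-1 1 := welE q rho.
have EAi i : Ai i = taft_act rho 0 (q^-1 ^+ i) 1 := PcompE q rho i 1.
have pn : q^-1 ^+ n = 1 := prim_root_inv_expn Hq.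
have pin i : (q^-1 ^+ i) ^+ n = 1 by rewrite exprAC pn expr1n.
move=> A1; split=> [Hrho|[[//]|[Hgrp A1_0 Hexp wn HAi]]].
  case: A1 => A1; [right | left; split=> //]; last first.
    by apply: (taft_act_global Hn Hq Hrho); rewrite -[q^-1]expr1 -EAi.
  have D1_0 : taft_act rho 0 q^-1 1 = 0 by rewrite -[q^-1]expr1 -EAi.
  have Drec a : taft_rec n q w (fun j y => taft_act rho j y a).
    by rewrite Ew; apply: taft_act_rec.
  have [Hexp wn] := taft_rec_expansion Hq Hn Drec (taft_act_counit Hq Hrho).
  split=> //.
    apply/(grp_partial_coactionP Hq); split=> [a|z a b zn|z y a zn yn].
    - exact: (taft_act_counit Hq Hrho).
    - exact: (taft_act0_mul Hn Hq Hrho).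
    by rewrite (taft_act0_act Hn Hq Hrho) // scale1r.
  move=> i; rewrite -[LHS]/(Pcomp q rho i w) PcompE EAi Ew.
  exact: (taft_act0_wel Hn Hq Hrho).
have [D01 D0M D0D] := (grp_partial_coactionP Hq rho).1 Hgrp.
have Drec := expansion_taft_rec Hq Hn wn Hexp.
apply: (rec_taft_partial_coaction Hn Hq D01 D0M D0D _ Drec) => z zn.
(* Condition (iii) concerns the powers of [q^-1], and these exhaust the n-th roots of unity. *)
have [i ->] := prim_rootP (prim_root_inv Hn Hq) zn.
by have := HAi i; rewrite -[LHS]/(Pcomp q rho i w) PcompE EAi.
Qed.
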